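(* Let $X$ be a path connected topological space with base point $x_0$, and let $p:\tilde X\to X$ be an $\mathbf{lpc}_0$-covering map with $p_*\pi_1(\tilde X,\tilde x_0)=H\le\pi_1(X,x_0)$, where $\tilde x_0\in p^{-1}(x_0)$. Then the fibers of $p$ are Hausdorff.
   Context: An $\mathbf{lpc}_0$-covering map (Brazas) is a continuous map $p:\tilde X\to X$ with $\tilde X$ path connected and locally path connected such that for every path connected, locally path connected space $Y$, every $y\in Y$, every $\tilde x\in\tilde X$, and every continuous map $f:(Y,y)\to(X,p(\tilde x))$ with $f_*\pi_1(Y,y)\subseteq p_*\pi_1(\tilde X,\tilde x)$, there is a unique continuous map $\tilde f:(Y,y)\to(\tilde X,\tilde x)$ with $p\circ\tilde f=f$. Fibers $p^{-1}(x)$ carry the subspace topology from $\tilde X$. *)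

(* Defs.v *)
From HB Require Import structures.
From mathcomp Require Import all_boot all_order all_algebra generic_quotient.
From mathcomp Require Import all_classical all_reals all_analysis.
From mathcomp Require Import wedge_sigT continuous_path.
From mathcomp Require Import ring lra.

Set Implicit Arguments.
Unset Strict Implicit.
Unset Printing Implicit Defensive.

Import Order.TTheory GRing.Theory Num.Theory.
Import numFieldNormedType.Exports.

Local Open Scope classical_set_scope.
Local Open Scope ring_scope.
Local Open Scope quotient_scope.

Definition unit_itv (R : realType) : Type := set_type (`[0, 1]%classic : set R).

HB.instance Definition _ (R : realType) :=
  Topological.copy (unit_itv R) (set_type (`[0, 1]%classic : set R)).

Section unit_interval.
Variable R : realType.
Local Notation I := (unit_itv R).

Definition itv_val (t : I) : R := \val t.

Lemma itv_val_inj : injective itv_val.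
Proof. exact: val_inj. Qed.

Lemma itv_valP (t : I) : 0 <= itv_val t <= 1.
Proof. by have := set_valP t; rewrite /= in_itv. Qed.

Lemma itv_val_continuous : continuous itv_val.
Proof. exact: initial_continuous. Qed.

Lemma clamp_subproof (r : R) :
  Num.max 0 (Num.min 1 r) \in (`[0, 1]%classic : set R).
Proof.
apply/mem_set; rewrite /= in_itv /= le_max lexx /=.
by rewrite ge_max ler01 ge_min lexx.
Qed.

(* Total retraction of R onto [0, 1]; it lets paths be reparametrized by
   real-valued formulas. *)
Definition clamp (r : R) : I := exist _ (Num.max 0 (Num.min 1 r)) (clamp_subproof r).

Lemma clamp_valE (r : R) : 0 <= r <= 1 -> itv_val (clamp r) = r.
Proof. by move=> /andP[r0 r1]; rewrite /itv_val /= min_r // max_r. Qed.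

Lemma clampK (t : I) : clamp (itv_val t) = t.
Proof. by apply: itv_val_inj; rewrite clamp_valE // itv_valP. Qed.

Lemma clamp_continuous : continuous clamp.
Proof.
apply: (@continuous_comp_initial _ R R (\val : I -> R) clamp) => r.
apply: (@continuous_max R R (cst 0) (fun r => Num.min 1 r)); first exact: cvg_cst.
by apply: (@continuous_min R R (cst 1) id); [exact: cvg_cst|exact: cvg_id].
Qed.

Lemma clamp01_neq : clamp 0 != clamp 1.
Proof.
apply/eqP => /(congr1 itv_val); rewrite !clamp_valE ?lexx ?ler01 //.
by move=> /eqP; rewrite eq_sym oner_eq0.
Qed.

HB.instance Definition _ := isBiPointed.Build I clamp01_neq.

Lemma itv_val0 : itv_val zero = 0.
Proof. by rewrite clamp_valE // lexx ler01. Qed.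

Lemma itv_val1 : itv_val one = 1.
Proof. by rewrite clamp_valE // lexx ler01. Qed.

Lemma clamp0 : clamp 0 = zero :> I. Proof. by []. Qed.
Lemma clamp1 : clamp 1 = one :> I. Proof. by []. Qed.

Lemma clamp_le0 (r : R) : r <= 0 -> clamp r = zero.
Proof.
move=> r0; apply: itv_val_inj; rewrite itv_val0 /itv_val /= max_l //.
by rewrite ge_min r0 orbT.
Qed.

Lemma clamp_ge1 (r : R) : 1 <= r -> clamp r = one.
Proof. by move=> r1; apply: itv_val_inj; rewrite itv_val1 /itv_val /= min_l ?max_r. Qed.

End unit_interval.

Arguments itv_val {R} t.
Arguments clamp {R} r.

Section affine.
Variables (R : realType) (T : topologicalType) (u : T -> R).
Hypothesis cu : continuous u.

Lemma affine_continuous (a b : R) : continuous (fun t => a * u t + b).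
Proof.
by move=> t; apply: cvgD; [apply: cvgM; [exact: cvg_cst|exact: cu]|exact: cvg_cst].
Qed.

Lemma double_continuous : continuous (fun t => 2 * u t).
Proof. by move=> t; apply: cvgM; [exact: cvg_cst|exact: cu]. Qed.

Lemma flip_continuous : continuous (fun t => 1 - u t).
Proof. by move=> t; apply: cvgB; [exact: cvg_cst|exact: cu]. Qed.

Lemma interpolate_continuous (v w : T -> R) : continuous v -> continuous w ->
  continuous (fun t => v t + u t * (w t - v t)).
Proof.
move=> cv cw t; apply: cvgD; first exact: cv.
by apply: cvgM; [exact: cu|apply: cvgB; [exact: cw|exact: cv]].
Qed.

Lemma clamp_comp_continuous : continuous (fun t => clamp (u t)).
Proof.
by move=> t; apply: (@continuous_comp _ _ _ u clamp);
  [exact: cu|exact: clamp_continuous].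
Qed.

Lemma itv_val_clamp_continuous : continuous (fun t => itv_val (clamp (u t))).
Proof.
move=> t; apply: (@continuous_comp _ _ _ (fun t => clamp (u t)) itv_val).
  exact: clamp_comp_continuous.
exact: itv_val_continuous.
Qed.

End affine.

Section pairing.
Variables (R : realType) (T : topologicalType).

Lemma itv_val_fst_continuous : continuous (fun st : unit_itv R * T => itv_val st.1).
Proof. by move=> st; apply: continuous_comp; [exact: cvg_fst|exact: itv_val_continuous]. Qed.

Lemma itv_val_snd_continuous : continuous (fun st : T * unit_itv R => itv_val st.2).
Proof. by move=> st; apply: continuous_comp; [exact: cvg_snd|exact: itv_val_continuous]. Qed.

Lemma comp_pair_continuous (A B C : topologicalType) (h : A * B -> C)
    (f : T -> A) (g : T -> B) :
  continuous h -> continuous f -> continuous g -> continuous (fun t => h (f t, g t)).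
Proof.
move=> ch cf cg t.
apply: (@continuous_comp _ _ _ (fun t => (f t, g t)) h); last exact: ch.
by apply: cvg_pair; [exact: cf|exact: cg].
Qed.

End pairing.

Section gluing.
Variables (R : realType) (T U : topologicalType).

Lemma glue_continuous (u : T -> R) (c : R) (f g : T -> U) :
  continuous u -> continuous f -> continuous g ->
  (forall t, u t = c -> f t = g t) ->
  continuous (fun t => if u t <= c then f t else g t).
Proof.
move=> cu cf cg fg; apply/continuous_subspace_setT.
have -> : [set: T] = u @^-1` [set r | r <= c] `|` u @^-1` [set r | c <= r].
  by apply/seteqP; split => // t _ /=; case/orP: (le_total (u t) c); [left|right].
apply: withinU_continuous.
- by apply: closed_comp; [move=> ? _; exact: cu|exact: closed_le].
- by apply: closed_comp; [move=> ? _; exact: cu|exact: closed_ge].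
- apply: (@subspace_eq_continuous _ _ _ f); last exact: continuous_subspaceT.
  by move=> t; rewrite inE /from_subspace /= => ->.
- apply: (@subspace_eq_continuous _ _ _ g); last exact: continuous_subspaceT.
  move=> t; rewrite inE /from_subspace /= => cut; case: ifPn => // utc.
  by apply/esym/fg/le_anti; rewrite utc.
Qed.

End gluing.

Section paths.
Variables (R : realType) (X : topologicalType).
Local Notation I := (unit_itv R).
Implicit Types x y z w : X.

(* Homotopy relative to the endpoints; the first coordinate is the
   deformation parameter. *)
Definition path_homotopic x y (a b : {path I from x to y in X}) : Prop :=
  exists h : I * I -> X, [/\ continuous h,
    (forall t, h (zero, t) = a t), (forall t, h (one, t) = b t),
    (forall s, h (s, zero) = x) & (forall s, h (s, one) = y)].

Definition concat_fun (a b : I -> X) (t : I) : X :=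
  if itv_val t <= 2^-1 then a (clamp (2 * itv_val t))
  else b (clamp (2 * itv_val t - 1)).

Lemma concat_funL (a b : I -> X) t : itv_val t <= 2^-1 ->
  concat_fun a b t = a (clamp (2 * itv_val t)).
Proof. by rewrite /concat_fun => ->. Qed.

Lemma concat_funR (a b : I -> X) t : 2^-1 < itv_val t ->
  concat_fun a b t = b (clamp (2 * itv_val t - 1)).
Proof. by rewrite /concat_fun ltNge => /negbTE ->. Qed.

Definition reverse_fun (a : I -> X) (t : I) : X := a (clamp (1 - itv_val t)).

Lemma comp_clamp_continuous (T : topologicalType) (u : T -> R) (a : I -> X) :
  continuous u -> continuous a -> continuous (fun t => a (clamp (u t))).
Proof.
move=> cu ca t; apply: (@continuous_comp _ _ _ (clamp \o u) a); last exact: ca.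
by apply: continuous_comp; [exact: cu|exact: clamp_continuous].
Qed.

Lemma concat_continuous (a b : I -> X) : continuous a -> continuous b ->
  a one = b zero -> continuous (concat_fun a b).
Proof.
move=> ca cb ab; apply: glue_continuous.
- exact: itv_val_continuous.
- by apply: comp_clamp_continuous => //; exact/double_continuous/itv_val_continuous.
- by apply: comp_clamp_continuous => //; exact/affine_continuous/itv_val_continuous.
- by move=> t ->; rewrite divff ?pnatr_eq0// subrr clamp0 clamp1.
Qed.

Section concat.
Variables (x y z : X).
Variables (a : {path I from x to y in X}) (b : {path I from y to z in X}).

Lemma concat_cts : continuous (concat_fun a b).
Proof. by apply: concat_continuous; [exact: cts_fun..|rewrite path_zero path_one]. Qed.

Lemma concat0 : concat_fun a b zero = x.
Proof. by rewrite /concat_fun itv_val0 invr_ge0 ler0n mulr0 clamp0 path_zero. Qed.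

Lemma concat1 : concat_fun a b one = z.
Proof.
rewrite /concat_fun itv_val1 ifF; last by apply/negbTE; rewrite -ltNge; lra.
by rewrite mulr1 (_ : 2 - 1 = 1); [rewrite clamp1 path_one|lra].
Qed.

Definition path_concat : {path I from x to z in X} := mk_path concat_cts concat0 concat1.

Lemma reverse_cts : continuous (reverse_fun a).
Proof.
apply: comp_clamp_continuous; last exact: cts_fun.
exact/flip_continuous/itv_val_continuous.
Qed.

Lemma reverse0 : reverse_fun a zero = y.
Proof. by rewrite /reverse_fun itv_val0 subr0 clamp1 path_one. Qed.

Lemma reverse1 : reverse_fun a one = x.
Proof. by rewrite /reverse_fun itv_val1 subrr clamp0 path_zero. Qed.

Definition path_reverse : {path I from y to x in X} :=
  mk_path reverse_cts reverse0 reverse1.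

End concat.

Definition path_cst x : {path I from x to x in X} :=
  mk_path (f := cst x) (fun=> cvg_cst _) erefl erefl.

Lemma path_homotopic_refl x y (a : {path I from x to y in X}) : path_homotopic a a.
Proof.
exists (fun st => a st.2); split=> //= [t|s|s]; rewrite ?path_zero ?path_one //.
by apply: continuous_comp; [exact: cvg_snd|exact: cts_fun].
Qed.


Lemma path_homotopic_sym x y (a b : {path I from x to y in X}) :
  path_homotopic a b -> path_homotopic b a.
Proof.
case=> h [ch h0 h1 hx hy].
exists (fun st => h (clamp (1 - itv_val st.1), st.2)); split=> [|t|t|s|s] /=.
- apply: comp_pair_continuous => //; last by move=> ?; exact: cvg_snd.
  exact/clamp_comp_continuous/flip_continuous/itv_val_fst_continuous.
- by rewrite itv_val0 subr0 clamp1.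
- by rewrite itv_val1 subrr clamp0.
- by rewrite hx.
- by rewrite hy.
Qed.

Lemma path_homotopic_trans x y (a b c : {path I from x to y in X}) :
  path_homotopic a b -> path_homotopic b c -> path_homotopic a c.
Proof.
case=> h [ch h0 h1 hx hy] [k [ck k0 k1 kx ky]].
exists (fun st => if itv_val st.1 <= 2^-1 then h (clamp (2 * itv_val st.1), st.2)
  else k (clamp (2 * itv_val st.1 - 1), st.2)); split=> [|t|t|s|s] /=.
- apply: (@glue_continuous _ _ _ (fun st : I * I => itv_val st.1) 2^-1
    (fun st => h (clamp (2 * itv_val st.1), st.2))
    (fun st => k (clamp (2 * itv_val st.1 - 1), st.2))).
  + exact: itv_val_fst_continuous.
  + apply: comp_pair_continuous => //; last by move=> ?; exact: cvg_snd.
    exact/clamp_comp_continuous/double_continuous/itv_val_fst_continuous.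
  + apply: comp_pair_continuous => //; last by move=> ?; exact: cvg_snd.
    exact/clamp_comp_continuous/affine_continuous/itv_val_fst_continuous.
  + by move=> st ->; rewrite divff ?pnatr_eq0// subrr clamp0 clamp1 h1 k0.
- by rewrite itv_val0 invr_ge0 ler0n mulr0 clamp0 h0.
- rewrite itv_val1 ifF; last by apply/negbTE; rewrite -ltNge; lra.
  by rewrite mulr1 (_ : 2 - 1 = 1); [rewrite clamp1 k1|lra].
- by case: ifP; rewrite ?hx ?kx.
- by case: ifP; rewrite ?hy ?ky.
Qed.

Lemma path_concat_homotopic x y z (a a' : {path I from x to y in X})
    (b b' : {path I from y to z in X}) :
  path_homotopic a a' -> path_homotopic b b' ->
  path_homotopic (path_concat a b) (path_concat a' b').
Proof.
case=> h [ch h0 h1 hx hy] [k [ck k0 k1 kx ky]].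
exists (fun st => if itv_val st.2 <= 2^-1 then h (st.1, clamp (2 * itv_val st.2))
  else k (st.1, clamp (2 * itv_val st.2 - 1))); split=> [|t|t|s|s] /=.
- apply: (@glue_continuous _ _ _ (fun st : I * I => itv_val st.2) 2^-1
    (fun st => h (st.1, clamp (2 * itv_val st.2)))
    (fun st => k (st.1, clamp (2 * itv_val st.2 - 1)))).
  + exact: itv_val_snd_continuous.
  + apply: comp_pair_continuous => //; first by move=> ?; exact: cvg_fst.
    exact/clamp_comp_continuous/double_continuous/itv_val_snd_continuous.
  + apply: comp_pair_continuous => //; first by move=> ?; exact: cvg_fst.
    exact/clamp_comp_continuous/affine_continuous/itv_val_snd_continuous.
  + by move=> st ->; rewrite divff ?pnatr_eq0// subrr clamp0 clamp1 hy kx.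
- by rewrite h0 k0.
- by rewrite h1 k1.
- by rewrite itv_val0 invr_ge0 ler0n mulr0 clamp0 hx.
- rewrite itv_val1 ifF; last by apply/negbTE; rewrite -ltNge; lra.
  by rewrite mulr1 (_ : 2 - 1 = 1); [rewrite clamp1 ky|lra].
Qed.

Lemma path_reverse_homotopic x y (a b : {path I from x to y in X}) :
  path_homotopic a b -> path_homotopic (path_reverse a) (path_reverse b).
Proof.
case=> h [ch h0 h1 hx hy].
exists (fun st => h (st.1, clamp (1 - itv_val st.2))); split=> [|t|t|s|s] /=.
- apply: comp_pair_continuous => //; first by move=> ?; exact: cvg_fst.
  exact/clamp_comp_continuous/flip_continuous/itv_val_snd_continuous.
- by rewrite h0.
- by rewrite h1.
- by rewrite itv_val0 subr0 clamp1 hy.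
- by rewrite itv_val1 subrr clamp0 hx.
Qed.

(* Two reparametrizations of the same path are joined by the straight-line
   homotopy; associativity, unit and inverse laws are instances. *)
Lemma reparam_homotopic x y (c : I -> X) (a b : {path I from x to y in X})
    (u v : I -> R) : continuous c -> continuous u -> continuous v ->
  u zero = v zero -> u one = v one ->
  (forall t, a t = c (clamp (u t))) -> (forall t, b t = c (clamp (v t))) ->
  path_homotopic a b.
Proof.
move=> cc cu cv uv0 uv1 au bv.
exists (fun st => c (clamp (u st.2 + itv_val st.1 * (v st.2 - u st.2)))).
split=> [|t|t|s|s] /=.
- apply: (@comp_clamp_continuous _
    (fun st : I * I => u st.2 + itv_val st.1 * (v st.2 - u st.2)) c) => //.
  apply: interpolate_continuous; first exact: itv_val_fst_continuous.
    by move=> st; apply: continuous_comp; [exact: cvg_snd|exact: cu].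
  by move=> st; apply: continuous_comp; [exact: cvg_snd|exact: cv].
- by rewrite itv_val0 mul0r addr0 au.
- by rewrite itv_val1 mul1r addrC subrK bv.
- by rewrite -uv0 subrr mulr0 addr0 -au path_zero.
- by rewrite -uv1 subrr mulr0 addr0 -au path_one.
Qed.

End paths.

Section fundamental_group.
Variables (R : realType) (X : topologicalType) (x : X).
Local Notation I := (unit_itv R).
Local Notation loop := {path I from x to x in X}.

Definition loop_homotopic : rel loop := fun a b => `[< path_homotopic a b >].

Lemma loop_homotopic_refl : reflexive loop_homotopic.
Proof. by move=> a; apply/asboolP; exact: path_homotopic_refl. Qed.

Lemma loop_homotopic_sym : symmetric loop_homotopic.
Proof. by move=> a b; apply/asboolP/asboolP; exact: path_homotopic_sym. Qed.

Lemma loop_homotopic_trans : transitive loop_homotopic.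
Proof.
move=> b a c /asboolP ab /asboolP bc; apply/asboolP.
exact: path_homotopic_trans ab bc.
Qed.

Definition loop_equiv :=
  EquivRel loop_homotopic loop_homotopic_refl loop_homotopic_sym loop_homotopic_trans.

Definition pi1 : Type := {eq_quot loop_equiv}.
HB.instance Definition _ := EqQuotient.on pi1.
HB.instance Definition _ := Choice.on pi1.

Definition loop_class (a : loop) : pi1 := \pi_pi1 a.

Lemma loop_classP (a b : loop) : loop_class a = loop_class b <-> path_homotopic a b.
Proof.
split=> [/eqmodP/asboolP|ab] //; exact/eqmodP/asboolP.
Qed.

Lemma loop_class_repr (c : pi1) : loop_class (repr c) = c.
Proof. exact: reprK. Qed.

Lemma loop_homotopic_repr (a : loop) : path_homotopic (repr (loop_class a)) a.
Proof. by apply/loop_classP; rewrite loop_class_repr. Qed.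

Definition pi1_one : pi1 := loop_class (path_cst R x).
Definition pi1_mul (c d : pi1) : pi1 := loop_class (path_concat (repr c) (repr d)).
Definition pi1_inv (c : pi1) : pi1 := loop_class (path_reverse (repr c)).

Lemma pi1_mulE (a b : loop) :
  pi1_mul (loop_class a) (loop_class b) = loop_class (path_concat a b).
Proof.
by apply/loop_classP; apply: path_concat_homotopic; exact: loop_homotopic_repr.
Qed.

Lemma pi1_invE (a : loop) : pi1_inv (loop_class a) = loop_class (path_reverse a).
Proof. by apply/loop_classP; apply: path_reverse_homotopic; exact: loop_homotopic_repr. Qed.

Lemma pi1_mulA : associative pi1_mul.
Proof.
move=> c d e; rewrite -[c]loop_class_repr -[d]loop_class_repr -[e]loop_class_repr.
move: (repr c) (repr d) (repr e) => {}c {}d {}e; rewrite !pi1_mulE.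
apply/loop_classP; pose b := path_concat (path_concat c d) e.
have cval := @itv_val_continuous R.
apply: (@reparam_homotopic R X x x b _ _ (fun t => if itv_val t <= 2^-1
    then 2^-1 * itv_val t + 0 else if itv_val t <= 3 / 4
    then 1 * itv_val t + - 4^-1 else 2 * itv_val t - 1) itv_val) => //.
- exact: cts_fun.
- apply: glue_continuous => //; first exact: affine_continuous.
    apply: glue_continuous => //; [exact: affine_continuous..|].
    by move=> t ->; lra.
  by move=> t ->; rewrite ifT; lra.
- by rewrite itv_val0 ifT; lra.
- by rewrite itv_val1 !ifF; lra.
- move=> t; have /andP[t0 t1] := itv_valP t; set u := (X in clamp X).
  change (concat_fun c (concat_fun d e) t =
          concat_fun (concat_fun c d) e (clamp u)).
  have clE r : 0 <= r <= 1 -> itv_val (clamp r) = r by exact: clamp_valE.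
  have [t2|t2] := leP (itv_val t) 2^-1.
    have uE : u = 2^-1 * itv_val t by rewrite /u t2 addr0.
    have vu : itv_val (clamp u) = 2^-1 * itv_val t by rewrite uE clE //; lra.
    have v2u : itv_val (clamp (2 * itv_val (clamp u))) = itv_val t.
      by rewrite vu clE; lra.
    rewrite concat_funL // concat_funL; last by rewrite vu; lra.
    by rewrite concat_funL v2u.
  have t2F : (itv_val t <= 2^-1) = false by apply/negbTE; rewrite -ltNge.
  have v2t : itv_val (clamp (2 * itv_val t - 1)) = 2 * itv_val t - 1.
    by rewrite clE; lra.
  rewrite concat_funR //; have [t4|t4] := leP (itv_val t) (3 / 4).
    have uE : u = itv_val t - 4^-1 by rewrite /u t2F t4 mul1r.
    have vu : itv_val (clamp u) = itv_val t - 4^-1 by rewrite uE clE //; lra.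
    have v2u : itv_val (clamp (2 * itv_val (clamp u))) = 2 * itv_val t - 2^-1.
      by rewrite vu clE; lra.
    rewrite concat_funL; last by rewrite v2t; lra.
    rewrite concat_funL; last by rewrite vu; lra.
    rewrite concat_funR; last by rewrite v2u; lra.
    by rewrite v2t v2u; congr (d (clamp _)); lra.
  have t4F : (itv_val t <= 3 / 4) = false by apply/negbTE; rewrite -ltNge.
  have uE : u = 2 * itv_val t - 1 by rewrite /u t2F t4F.
  have vu : itv_val (clamp u) = 2 * itv_val t - 1 by rewrite uE clE //; lra.
  rewrite concat_funR; last by rewrite v2t; lra.
  by rewrite concat_funR vu ?v2t //; lra.
- by move=> t; rewrite clampK.
Qed.

Lemma pi1_mul1g : left_id pi1_one pi1_mul.
Proof.
move=> c; rewrite -[c]loop_class_repr; move: (repr c) => {}c; rewrite pi1_mulE.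
apply/loop_classP; have cval := @itv_val_continuous R.
apply: (@reparam_homotopic R X x x c _ _
  (fun t => itv_val (clamp (2 * itv_val t - 1))) itv_val) => //.
- exact: cts_fun.
- exact/itv_val_clamp_continuous/affine_continuous.
- by rewrite itv_val0 clamp_le0 ?itv_val0 //; lra.
- by rewrite itv_val1 (_ : 2 * 1 - 1 = 1); [rewrite clamp1 itv_val1|lra].
- move=> t; rewrite clampK /= /mk_path /concat_fun; case: ifPn => // t2 /=.
  by rewrite clamp_le0 ?path_zero //; lra.
- by move=> t; rewrite clampK.
Qed.

Lemma pi1_mulg1 : right_id pi1_one pi1_mul.
Proof.
move=> c; rewrite -[c]loop_class_repr; move: (repr c) => {}c; rewrite pi1_mulE.
apply/loop_classP; have cval := @itv_val_continuous R.
apply: (@reparam_homotopic R X x x c _ _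
  (fun t => itv_val (clamp (2 * itv_val t))) itv_val) => //.
- exact: cts_fun.
- exact/itv_val_clamp_continuous/double_continuous.
- by rewrite itv_val0 mulr0 clamp0 itv_val0.
- by rewrite itv_val1 clamp_ge1 ?itv_val1 //; lra.
- move=> t; rewrite clampK /= /mk_path /concat_fun; case: ifPn => // t2 /=.
  by rewrite clamp_ge1 ?path_one //; lra.
- by move=> t; rewrite clampK.
Qed.

Lemma pi1_mulVg : left_inverse pi1_one pi1_inv pi1_mul.
Proof.
move=> c; rewrite -[c]loop_class_repr; move: (repr c) => {}c.
rewrite pi1_invE pi1_mulE; apply/loop_classP; have cval := @itv_val_continuous R.
apply: (@reparam_homotopic R X x x c _ _ (fun t => if itv_val t <= 2^-1
    then - 2 * itv_val t + 1 else 2 * itv_val t - 1) (cst 1)) => //.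
- exact: cts_fun.
- apply: glue_continuous => //; [exact: affine_continuous..|].
  by move=> t ->; lra.
- exact: cst_continuous.
- by rewrite itv_val0 ifT /=; lra.
- by rewrite itv_val1 ifF /=; lra.
- move=> t; have /andP[t0 t1] := itv_valP t.
  rewrite /= /mk_path /concat_fun /=; case: ifPn => // t2.
  by rewrite /reverse_fun clamp_valE; [congr (c (clamp _))|]; lra.
- by move=> t; rewrite /= clamp1 path_one.
Qed.

Lemma pi1_mulgV : right_inverse pi1_one pi1_inv pi1_mul.
Proof.
move=> c; rewrite -[c]loop_class_repr; move: (repr c) => {}c.
rewrite pi1_invE pi1_mulE; apply/loop_classP; have cval := @itv_val_continuous R.
apply: (@reparam_homotopic R X x x c _ _ (fun t => if itv_val t <= 2^-1
    then 2 * itv_val t + 0 else - 2 * itv_val t + 2) (cst 0)) => //.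
- exact: cts_fun.
- apply: glue_continuous => //; [exact: affine_continuous..|].
  by move=> t ->; lra.
- exact: cst_continuous.
- by rewrite itv_val0 ifT /=; lra.
- by rewrite itv_val1 ifF /=; lra.
- move=> t; have /andP[t0 t1] := itv_valP t.
  rewrite /= /mk_path /concat_fun /=; case: ifPn => t2; first by rewrite addr0.
  by rewrite /reverse_fun clamp_valE; [congr (c (clamp _))|]; lra.
- by move=> t; rewrite /= clamp0 path_zero.
Qed.

HB.instance Definition _ :=
  isGroup.Build pi1 pi1_mulA pi1_mul1g pi1_mulg1 pi1_mulVg pi1_mulgV.

Lemma pi1_mulgE (a b : loop) :
  (loop_class a * loop_class b)%g = loop_class (path_concat a b).
Proof. exact: pi1_mulE. Qed.

End fundamental_group.

Arguments pi1 R {X} x.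

Section induced_map.
Variables (R : realType) (X Y : topologicalType) (f : continuousType X Y).
Variables (x : X) (y : Y) (fxy : f x = y).
Local Notation I := (unit_itv R).

Lemma path_image_cts (a : {path I from x to x in X}) : continuous (f \o a).
Proof. exact: cts_fun. Qed.

Lemma path_image0 (a : {path I from x to x in X}) : (f \o a) zero = y.
Proof. by rewrite /= path_zero. Qed.

Lemma path_image1 (a : {path I from x to x in X}) : (f \o a) one = y.
Proof. by rewrite /= path_one. Qed.

Definition loop_image (a : {path I from x to x in X}) : {path I from y to y in Y} :=
  mk_path (@path_image_cts a) (path_image0 a) (path_image1 a).

Definition pi1_map (c : pi1 R x) : pi1 R y := loop_class (loop_image (repr c)).

Lemma pi1_mapE (a : {path I from x to x in X}) :
  pi1_map (loop_class a) = loop_class (loop_image a).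
Proof.
apply/loop_classP; have [h [ch h0 h1 hx hy]] := loop_homotopic_repr a.
exists (f \o h); split=> [st|t|t|s|s] /=.
- by apply: continuous_comp; [exact: ch|exact: cts_fun].
- by rewrite h0.
- by rewrite h1.
- by rewrite hx.
- by rewrite hy.
Qed.

Lemma pi1_mapM : {morph pi1_map : c d / (c * d)%g}.
Proof.
move=> c d; rewrite -[c]loop_class_repr -[d]loop_class_repr.
move: (repr c) (repr d) => {}c {}d; rewrite pi1_mulgE !pi1_mapE pi1_mulgE.
congr loop_class; apply/path_eqP => t /=.
by rewrite /mk_path /= /concat_fun /=; case: ifP.
Qed.

End induced_map.

Arguments pi1_map R {X Y} f {x y} fxy c.

(* Path connectedness of the subspace A: paths are required to stay inside A,
   and the empty set does not count as path connected. *)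
Definition path_connected (R : realType) (X : topologicalType) (A : set X) : Prop :=
  A !=set0 /\ forall x y, A x -> A y ->
    exists a : {path unit_itv R from x to y in X}, range a `<=` A.

Definition locally_path_connected (R : realType) (X : topologicalType) : Prop :=
  forall (x : X) (U : set X), nbhs x U ->
    exists V : set X, [/\ open V, V x, V `<=` U & path_connected R V].

(* [fy] turns f into a based map (Y, y) -> (X, p e), so that both f_* and p_*
   land in the fundamental group at p e. *)
Definition lpc0_covering (R : realType) (E X : topologicalType)
    (p : continuousType E X) : Prop :=
  [/\ path_connected R [set: E], locally_path_connected R E &
    forall (Y : topologicalType) (y : Y) (e : E) (f : continuousType Y X)
        (fy : f y = p e),
      path_connected R [set: Y] -> locally_path_connected R Y ->
      range (pi1_map R f fy) `<=` range (pi1_map R p (erefl (p e))) ->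
      exists! g : continuousType Y E, g y = e /\ p \o g = f].

(* Main.v *)
From HB Require Import structures.
Require Import Defs.
From mathcomp Require Import all_boot all_order all_algebra.
From mathcomp Require Import all_classical all_reals all_analysis.
From mathcomp Require Import continuous_path lra.

(** Points of a fibre of an lpc_0-covering [p : E -> X] are even separated by
    open sets of [E].

    Unique lifting of paths has the following consequence ([fibre_T0]). If
    [p a = p b] and every neighbourhood of [a] contains [b], then the line that
    sits at [b] except at one instant, when it jumps to [a], is continuous; it
    and the constant line [b] lift the same constant line, so [a = b].

    Now let [a], [b] be two points over [x] all of whose neighbourhoods meet.
    Since [E] is locally path connected, for each neighbourhood [U] of [x] there
    is a path [l U] from [a] to [b] whose projection stays in [U]: go from [a]
    to a common point of two small path connected neighbourhoods of [a] and [b],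
    then on to [b] ([inseparable_small_line]). [X] need not be first countable,
    so these paths are not strung along a sequence; their projections are glued
    at [x] into one map defined on a hedgehog with one spine for each subset of
    [X]. A neighbourhood of the centre of the hedgehog contains the whole spine
    [U] as soon as [U] is small, which is what makes the glued map continuous.
    The hedgehog is locally path connected and contracts to its centre, so the
    map has a lift sending the centre to [a] ([hedgehog_lift]), and by
    uniqueness the spine [U] is lifted to [l U]. Continuity of the lift at the
    centre puts [b = l U 1] into every neighbourhood of [a], and [a = b] follows
    ([fibre_separated]).

    Uniqueness of lifts of lines is also obtained from hedgehogs: the real line
    is a hedgehog with a single spine ([line_lift_unique]). *)

Set Implicit Arguments.
Unset Strict Implicit.
Unset Printing Implicit Defensive.

Import Order.TTheory GRing.Theory Num.Theory.
Import numFieldNormedType.Exports.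

Local Open Scope classical_set_scope.
Local Open Scope ring_scope.

(** * Points joined by a path inside a set *)

Definition joined (R : realType) (X : topologicalType) (A : set X) (x y : X) :=
  exists a : {path unit_itv R from x to y in X}, range a `<=` A.

Section joined_theory.
Variables (R : realType) (X : topologicalType) (A : set X).
Local Notation I := (unit_itv R).

Lemma joined_fun x y (u : I -> X) : continuous u -> u zero = x -> u one = y ->
  range u `<=` A -> joined R A x y.
Proof. by move=> cu u0 u1 uA; exists (mk_path cu u0 u1). Qed.

Lemma joined_trans x y z : joined R A x y -> joined R A y z -> joined R A x z.
Proof.
move=> [a aA] [b bA]; exists (path_concat a b) => _ [t _ <-].
rewrite /= /mk_path /concat_fun.
by case: ifP => _; [apply: aA|apply: bA]; exact: imageT.
Qed.

Lemma joined_sym x y : joined R A x y -> joined R A y x.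
Proof.
move=> [a aA]; exists (path_reverse a) => _ [t _ <-].
by apply: aA; exact: imageT.
Qed.

Lemma path_connected_star c : A c -> (forall x, A x -> joined R A x c) ->
  path_connected R A.
Proof.
move=> Ac toc; split; first by exists c.
move=> x y Ax Ay; have yc := toc y Ay.
exact: joined_trans (toc x Ax) (joined_sym yc).
Qed.

End joined_theory.

(** * The hedgehog of a filter *)

Lemma near_neq (R : realType) (t c : R) : t != c -> \forall s \near t, s != c.
Proof. by move=> tc; apply: open_nbhs_nbhs; split=> //; exact: open_neq. Qed.

(** The spines are copies of the whole line, indexed by [J]. The points [(k, 0)]
    are not identified: they form an indiscrete set, which plays the role of the
    centre and spares a quotient. The filter [G] says which families of spines
    are long near the centre. *)
Definition hedgehog (R : realType) (J : choiceType) (G : filter_on J) : Type :=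
  (J * R)%type.

Section hedgehog_topology.
Variables (R : realType) (J : choiceType) (G : filter_on J).
Local Notation H := (hedgehog R G).

(** No common radius is asked of the slices at the centre: a map that is
    continuous on each spine then needs no uniformity there beyond the one
    along [G]. *)
Definition hedgehog_nbhs (z : H) : set_system H :=
  [set W | if z.2 == 0 then (forall k, \forall s \near (0 : R), W (k, s)) /\
                            (\forall k \near G, forall s, W (k, s))
           else \forall s \near z.2, W (z.1, s)].

Lemma hedgehog_nbhs0 k (W : set H) : hedgehog_nbhs (k, 0) W =
  ((forall l, \forall s \near (0 : R), W (l, s)) /\
   (\forall l \near G, forall s, W (l, s))).
Proof. by rewrite /hedgehog_nbhs /= eqxx. Qed.

Lemma hedgehog_nbhsN0 k t (W : set H) : t != 0 ->
  hedgehog_nbhs (k, t) W = \forall s \near t, W (k, s).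
Proof. by move=> /negbTE t0; rewrite /hedgehog_nbhs /= t0. Qed.

Lemma hedgehog_nbhs_slice k t (W : set H) :
  hedgehog_nbhs (k, t) W -> \forall s \near t, W (k, s).
Proof.
have [->|t0] := eqVneq t 0; last by rewrite hedgehog_nbhsN0.
by rewrite hedgehog_nbhs0 => -[].
Qed.

Let hedgehog_nbhs_singleton (z : H) (W : set H) : hedgehog_nbhs z W -> W z.
Proof. by case: z => k t /hedgehog_nbhs_slice /nbhs_singleton. Qed.

Let hedgehog_nbhs_filter (z : H) : ProperFilter (hedgehog_nbhs z).
Proof.
apply: Build_ProperFilter_ex => [W Wz|].
  by exists z; exact: hedgehog_nbhs_singleton.
case: z => k t; have [->|t0] := eqVneq t 0; split.
- by rewrite hedgehog_nbhs0; split=> [l|]; exact: filterE.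
- move=> V W; rewrite !hedgehog_nbhs0 => -[V0 VG] [W0 WG]; split=> [l|].
    exact: filterI (V0 l) (W0 l).
  by apply: filterS2 VG WG => l Vl Wl s; split.
- move=> V W VW; rewrite !hedgehog_nbhs0 => -[V0 VG]; split=> [l|].
    by apply: filterS (V0 l) => s; exact: VW.
  by apply: filterS VG => l Vl s; exact: VW.
- by rewrite hedgehog_nbhsN0 //; exact: filterE.
- by move=> V W; rewrite !hedgehog_nbhsN0 //; exact: filterI.
- by move=> V W VW; rewrite !hedgehog_nbhsN0 //; apply: filterS => s; exact: VW.
Qed.

Let hedgehog_nbhs_nbhs (z : H) (W : set H) :
  hedgehog_nbhs z W -> hedgehog_nbhs z (hedgehog_nbhs^~ W).
Proof.
case: z => k t; have [->|t0] := eqVneq t 0.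
  rewrite !hedgehog_nbhs0 => WW; have [W0 WG] := WW.
  have Wl l s : (\forall r \near s, W (l, r)) -> hedgehog_nbhs (l, s) W.
    by have [->|s0] := eqVneq s 0; rewrite ?hedgehog_nbhs0 ?hedgehog_nbhsN0.
  split=> [l|]; first by apply: filterS (near_join (W0 l)) => s; exact: Wl.
  by apply: filterS WG => l Wls s; apply: Wl; exact: filterE.
rewrite !hedgehog_nbhsN0 // => Wk.
have t0' : \forall s \near t, s != 0 by exact: near_neq.
by apply: filterS2 t0' (near_join Wk) => s s0; rewrite hedgehog_nbhsN0.
Qed.

HB.instance Definition _ := Choice.copy H (J * R)%type.
HB.instance Definition _ := hasNbhs.Build H hedgehog_nbhs.
HB.instance Definition _ := Nbhs_isNbhsTopological.Build H
  hedgehog_nbhs_filter hedgehog_nbhs_singleton hedgehog_nbhs_nbhs.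

Lemma nbhs_centre k (W : set H) : nbhs ((k, 0) : H) W <->
  (forall l, \forall s \near (0 : R), W (l, s)) /\
  (\forall l \near G, forall s, W (l, s)).
Proof. by rewrite -(hedgehog_nbhs0 k). Qed.

Lemma nbhs_spine k t (W : set H) : t != 0 ->
  nbhs ((k, t) : H) W <-> \forall s \near t, W (k, s).
Proof. by move=> t0; rewrite -hedgehog_nbhsN0. Qed.

Lemma spine_continuous k : continuous (fun s => (k, s) : H).
Proof. by move=> t W /hedgehog_nbhs_slice. Qed.

(** A family of lines through [x] that converges uniformly to [x] along [G]
    glues to a continuous map. *)
Lemma hedgehog_continuous (X : topologicalType) (x : X) (l : J -> R -> X) :
  (forall k, continuous (l k)) -> (forall k, l k 0 = x) ->
  (forall U, nbhs x U -> \forall k \near G, forall s, U (l k s)) ->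
  continuous (fun z : H => l z.1 z.2).
Proof.
move=> cl l0 lG [k t] W /= Wx; have [t0|t0] := eqVneq t 0; last first.
  by apply: (nbhs_spine _ _ t0).2; exact: cl Wx.
move: Wx; rewrite t0 l0 => Wx; apply/nbhs_centre; split=> [j|]; last exact: lG.
by apply: (cl j 0); rewrite l0.
Qed.

End hedgehog_topology.

(** * Hedgehogs are locally path connected and contractible *)

Section hedgehog_paths.
Variables (R : realType) (J : choiceType) (G : filter_on J).
Local Notation H := (hedgehog R G).
Local Notation I := (unit_itv R).

Lemma spine_joined (V : set H) k s t :
  (forall r, 0 <= r <= 1 -> V (k, (t - s) * r + s)) -> joined R V (k, s) (k, t).
Proof.
move=> Vst; pose u (r : I) : H := (k, (t - s) * itv_val r + s).
apply: (@joined_fun R _ V _ _ u).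
- move=> r; apply: (@continuous_comp _ _ _ (fun r => (t - s) * itv_val r + s)
    (fun s => (k, s) : H)); last exact: spine_continuous.
  exact/affine_continuous/itv_val_continuous.
- by rewrite /u itv_val0 mulr0 add0r.
- by rewrite /u itv_val1 mulr1 subrK.
- by move=> _ [r _ <-]; apply: Vst; exact: itv_valP.
Qed.

(** Any function into the centre is continuous, so a path may jump from one
    central point to another. *)
Lemma centre_joined (V : set H) k l : V (k, 0) -> V (l, 0) ->
  joined R V (k, 0) (l, 0).
Proof.
move=> Vk Vl; pose u (r : I) : H := (if r == one then l else k, 0).
apply: (@joined_fun R _ V _ _ u).
- move=> r W /nbhs_centre[W0 _]; apply: (@filterE _ (nbhs r)) => s.
  exact: nbhs_singleton (W0 _).
- by rewrite /u ifF //; apply/negbTE; exact: zero_one_neq.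
- by rewrite /u eqxx.
- by move=> _ [r _ <-]; rewrite /u; case: ifP.
Qed.

Lemma star_path_connected (V : set H) (k : J) :
  (forall l, V (l, 0)) ->
  (forall l s r, 0 <= r <= 1 -> V (l, s) -> V (l, r * s)) ->
  path_connected R V.
Proof.
move=> V0 Vstar; apply: (@path_connected_star R _ V (k, 0)) => // -[l s] Vs.
apply: joined_trans (centre_joined (V0 l) (V0 k)).
apply: spine_joined => r r01; rewrite (_ : _ + s = (1 - r) * s); last by lra.
by apply: Vstar => //; lra.
Qed.

(** On each spine, the symmetric intervals about 0 that lie in [W] form an open
    star; taking the union of all of them avoids a choice of radii, and it is a
    whole spine whenever [W] contains that spine. *)
Lemma centre_star_nbhs k (W : set H) : nbhs ((k, 0) : H) W ->
  exists V : set H, [/\ open V, V `<=` W, forall l, V (l, 0) &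
    forall l s r, 0 <= r <= 1 -> V (l, s) -> V (l, r * s)].
Proof.
move=> /nbhs_centre[W0 WG].
pose V : set H :=
  [set z | exists e, `|z.2| < e /\ forall r, `|r| < e -> W (z.1, r)].
have V0 l : \forall s \near (0 : R), V (l, s).
  have /nbhs_ballP[e /= e0 We] := W0 l.
  apply/nbhs_ballP; exists e => //= s; rewrite /ball /= sub0r normrN => se.
  by exists e; split=> // r re; apply: We; rewrite /ball /= sub0r normrN.
exists V; split.
- rewrite openE => -[l s] [e [/= se We]].
  have [s0|s0] := eqVneq s 0.
    rewrite /interior s0; apply/nbhs_centre; split=> //.
    by apply: filterS WG => m Wm r; exists (`|r| + 1); rewrite /= ltrDl.
  apply/(nbhs_spine _ _ s0).
  have cn : \forall r \near s, `|r| < e.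
    have := @norm_continuous R R^o s [set y | y < e]; apply.
    by apply: open_nbhs_nbhs; split => //; exact: open_lt.
  by apply: filterS cn => r re; exists e.
- by move=> [l s] [e [/= se We]]; exact: We.
- by move=> l; exact: nbhs_singleton (V0 l).
- move=> l s r /andP[r0 r1] [e [/= se We]]; exists e; split=> //=.
  by apply: le_lt_trans se; rewrite normrM ger0_norm // ler_piMl.
Qed.

Lemma hedgehog_locally_path_connected : locally_path_connected R H.
Proof.
move=> [k t] W Wt; have [t0|t0] := eqVneq t 0.
  move: Wt; rewrite t0 => /centre_star_nbhs[V [oV VW V0 Vstar]].
  by exists V; split=> //; exact: star_path_connected k V0 Vstar.
move: Wt => /(nbhs_spine _ _ t0) Wt.
have [e [e0 We e0']] : exists e : R,
    [/\ 0 < e, forall s, `|t - s| < e -> W (k, s) & e <= `|t|].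
  have /nbhs_ballP[e /= e0 We] := Wt; exists (Num.min e `|t|); split.
  - by rewrite lt_min e0 normr_gt0.
  - by move=> s; rewrite lt_min => /andP[se _]; exact: We.
  - by rewrite ge_min lexx orbT.
(* As [e <= `|t|], this interval misses the centre, hence it is open. *)
pose V : set H := [set z | z.1 = k /\ `|t - z.2| < e].
have Vt : V (k, t) by split=> //=; rewrite subrr normr0.
exists V; split=> //.
- rewrite openE => -[l s] [/= -> se].
  have s0 : s != 0 by apply: contraTneq se => ->; rewrite subr0 -leNgt.
  apply/(nbhs_spine _ _ s0).
  have te : \forall r \near s, ball t e r.
    by apply: open_nbhs_nbhs; split=> //; exact: ball_open.
  by apply: filterS te.
- by move=> [l s] [/= -> ?]; exact: We.
- apply: (@path_connected_star R _ V (k, t)) => // -[l s] [/= -> se].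
  apply: spine_joined => r /andP[r0 r1]; split=> //=.
  rewrite (_ : t - _ = (1 - r) * (t - s)); last by lra.
  by apply: le_lt_trans se; rewrite normrM ger0_norm ?ler_piMl //; lra.
Qed.

Lemma hedgehog_path_connected (k : J) : path_connected R [set: H].
Proof. exact: (@star_path_connected [set: H] k). Qed.

(** The contraction is continuous at the centre because star neighbourhoods are
    stable under it; elsewhere it moves points along a single spine. *)
Lemma contraction_continuous :
  continuous (fun sz : I * H => (sz.2.1, (1 - itv_val sz.1) * sz.2.2) : H).
Proof.
move=> [s [k t]] W /= Wst; have [t0|t0] := eqVneq t 0.
  move: Wst; rewrite t0 mulr0 => /centre_star_nbhs[V [oV VW V0 Vstar]].
  exists ([set: I], V); first
    by split; [exact: filterT|apply: open_nbhs_nbhs; split => /=].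
  move=> [r [l y]] [_ /= Vy]; apply: VW; apply: Vstar => //.
  by have := itv_valP r; lra.
have cF : continuous (fun sr : I * R => (k, (1 - itv_val sr.1) * sr.2) : H).
  move=> sr; apply: (@continuous_comp _ _ _
    (fun sr : I * R => (1 - itv_val sr.1) * sr.2) (fun s => (k, s) : H));
    last exact: spine_continuous.
  apply: cvgM; last exact: cvg_snd.
  by apply: cvgB; [exact: cvg_cst|exact: itv_val_fst_continuous].
have [[A B] [/= As Bt] AB] := cF (s, t) W Wst.
exists (A, [set z : H | z.1 = k /\ B z.2]).
  split=> //=; apply/(nbhs_spine _ _ t0).
  by apply: filterS Bt => r.
by move=> [r [l y]] [/= Ar [-> By]]; exact: (AB (r, y)).
Qed.

End hedgehog_paths.

(** * Lifting hedgehogs, and separation in the fibres *)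

Section lifting.
Variables (R : realType) (E X : topologicalType) (p : continuousType E X).
Hypothesis hp : lpc0_covering R p.

(** Every loop of the hedgehog based at a central point is carried to the centre
    by the contraction, and [f] is constant there; so [f] kills the fundamental
    group and the lifting criterion holds. *)
Lemma hedgehog_lift (J : choiceType) (G : filter_on J) (k : J)
    (f : hedgehog R G -> X) (e : E) :
  continuous f -> (forall l, f (l, 0) = p e) ->
  exists! g : hedgehog R G -> E,
    [/\ continuous g, g (k, 0) = e & p \o g = f].
Proof.
move=> cf f0; have [_ _ lift] := hp.
have := lift (hedgehog R G) (k, 0) e (mkcts cf) (f0 k).
case; [exact: hedgehog_path_connected|exact: hedgehog_locally_path_connected| |].
  move=> _ [c _ <-]; rewrite -[c]loop_class_repr pi1_mapE.
  move: (repr c) => {}c; exists (loop_class (path_cst R e)) => //.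
  rewrite pi1_mapE; apply/loop_classP/path_homotopic_sym.
  exists (fun sr => f ((c sr.2).1, (1 - itv_val sr.1) * (c sr.2).2)).
  split=> [|r|r|s|s].
  - have cc : continuous (fun sr : unit_itv R * unit_itv R => c sr.2).
      by move=> ?; apply: continuous_comp; [exact: cvg_snd|exact: cts_fun].
    have cfst : continuous (fst : unit_itv R * unit_itv R -> unit_itv R).
      by move=> ?; exact: cvg_fst.
    have ch := comp_pair_continuous (@contraction_continuous R J G) cfst cc.
    move=> sr; apply: (@continuous_comp _ _ _ _ f); [exact: ch|exact: cf].
  - by rewrite itv_val0 subr0 mul1r /= -surjective_pairing.
  - by rewrite itv_val1 subrr mul0r f0.
  - by rewrite path_zero /= mulr0.
  - by rewrite path_one /= mulr0.
move=> g [[gk pg] gU]; exists g; split; first by split=> //; exact: cts_fun.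
by move=> g' [cg' g'k pg']; rewrite (gU (mkcts cg')).
Qed.

(** With one spine and the improper filter, which imposes nothing on whole
    spines, the hedgehog is the real line. *)
Lemma line_lift_unique (u v : R -> E) : continuous u -> continuous v ->
  p \o u = p \o v -> u 0 = v 0 -> u = v.
Proof.
move=> cu cv puv uv0; pose G := FilterType _ (@filter_setT unit).
pose U (w : R -> E) (z : hedgehog R G) := w z.2.
have cU w : continuous w -> continuous (U w).
  by move=> cw; exact: (@hedgehog_continuous _ _ G _ (w 0) (fun=> w)).
have cpU : continuous (p \o U u).
  by move=> z; apply: continuous_comp; [exact: cU|exact: cts_fun].
have [g [_ gU]] := @hedgehog_lift _ G tt _ (u 0) cpU (fun=> erefl).
have gu : g = U u by apply: gU; split; [exact: cU| |].
have gv : g = U v.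
  apply: gU; split; [exact: cU|exact: esym|].
  by apply/funext => z; have := congr1 (@^~ z.2) puv.
have Uuv : U u = U v by rewrite -gu.
by apply/funext => s; have := congr1 (@^~ (tt, s)) Uuv.
Qed.

(** The line equal to [a] at time 1 and to [b] at other times is continuous,
    since the neighbourhoods of [a] contain [b]. It shares its projection and its
    value at 0 with the constant line [b]. *)
Lemma fibre_T0 (a b : E) : p a = p b -> (forall N, nbhs a N -> N b) -> a = b.
Proof.
move=> pab ab; pose u (s : R) := if s == 1 then a else b.
have cu : continuous u.
  move=> s N; rewrite /u; have [->|s1] := eqVneq s 1 => Ns.
    apply: (@filterE _ (nbhs (1 : R))) => r /=; case: ifP => _; last exact: ab.
    exact: nbhs_singleton.
  have : \forall r \near s, r != 1 by exact: near_neq.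
  by apply: filterS => r /negbTE /= ->; exact: nbhs_singleton.
have : u = cst b.
  apply: line_lift_unique => //; first exact: cst_continuous.
    by apply/funext => s; rewrite /u /=; case: ifP.
  by rewrite /u eq_sym oner_eq0.
by move=> /(congr1 (@^~ 1)); rewrite /u eqxx.
Qed.

(** The line runs inside [p @^-1` U] through a common point of path connected
    neighbourhoods of [a] and [b]; it is a path extended by constants outside
    the unit interval. *)
Lemma inseparable_small_line (a b : E) (U : set X) :
  p a = p b -> cluster (nbhs a) b -> nbhs (p a) U ->
  exists u : R -> E, [/\ continuous u, u 0 = a, u 1 = b & forall s, U (p (u s))].
Proof.
move=> pab ab Ua; have [_ lpc _] := hp.
have [V [oV Va VU pcV]] := lpc a (p @^-1` U) (@cts_fun _ _ p a _ Ua).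
have Ub : nbhs (p b) U by rewrite -pab.
have [W [oW Wb WU pcW]] := lpc b (p @^-1` U) (@cts_fun _ _ p b _ Ub).
have [c [Vc Wc]] :=
  ab V W (open_nbhs_nbhs (conj oV Va)) (open_nbhs_nbhs (conj oW Wb)).
have [x1 x1V] := pcV.2 a c Va Vc; have [x2 x2W] := pcW.2 c b Wc Wb.
have [q qU] : joined R (p @^-1` U) a b.
  by apply: (@joined_trans _ _ _ _ c);
    [exists x1; apply: subset_trans VU|exists x2; apply: subset_trans WU].
exists (fun s => q (clamp s)); split.
- apply: (@comp_clamp_continuous _ _ _ id); last exact: cts_fun.
  by move=> ?; exact: cvg_id.
- by rewrite clamp0 path_zero.
- by rewrite clamp1 path_one.
- by move=> s; apply: qU; exact: imageT.
Qed.

(** The hedgehog is indexed by all subsets of [X], filtered towards small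
    neighbourhoods of [p a]. Its spines are mapped to the projections of lines
    from [a] to [b]; the lift starting at [a] takes whole spines into any given
    neighbourhood [N] of [a], hence [b] lies in [N]. *)
Lemma fibre_separated (a b : E) : p a = p b -> cluster (nbhs a) b -> a = b.
Proof.
move=> pab ab; apply: fibre_T0 => // N Na.
have FG : Filter (powerset_filter_from (nbhs (p a))) by exact: filter_filter.
pose G := FilterType _ FG.
have /choice[l lP] : forall U : set X, exists u : R -> E,
    [/\ continuous u, u 0 = a &
        nbhs (p a) U -> u 1 = b /\ forall s, U (p (u s))].
  move=> U; have [Ua|nUa] := pselect (nbhs (p a) U); last first.
    (* A default for the sets that are not neighbourhoods of [p a]. *)
    by exists (cst a); split=> //; exact: cst_continuous.
  have [u [cu u0 u1 uU]] := inseparable_small_line pab ab Ua.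
  by exists u; split.
pose f (z : hedgehog R G) := p (l z.1 z.2).
have cf : continuous f.
  apply: (@hedgehog_continuous _ _ G _ (p a) (fun k s => p (l k s))).
  - move=> k s; have [cl _ _] := lP k.
    by apply: continuous_comp; [exact: cl|exact: cts_fun].
  - by move=> k; have [_ -> _] := lP k.
  - move=> U Ua.
    apply: filterS2 (near_small_set _) (small_set_sub Ua) => k ka kU s.
    by have [_ _ /(_ ka)[_ kl]] := lP k; apply: kU.
have f0 k : f (k, 0) = p a by rewrite /f /=; have [_ -> _] := lP k.
have [g [[cg g0 pg] _]] := @hedgehog_lift _ G setT f a cf f0.
have Ng : nbhs ((setT, 0) : hedgehog R G) (g @^-1` N) by apply: cg; rewrite g0.
(* The central points are pairwise indistinguishable and their lifts lie in one
   fibre. *)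
have gc k : a = g (k, 0).
  apply: fibre_T0; first by rewrite -(f0 k) -pg.
  move=> M Ma; have : nbhs ((setT, 0) : hedgehog R G) (g @^-1` M).
    by apply: cg; rewrite g0.
  by move=> /nbhs_centre[/(_ k) + _]; exact: nbhs_singleton.
have /nbhs_centre[_ NG] := Ng.
have /filter_ex[k [ka kN]] : \forall k \near powerset_filter_from (nbhs (p a)),
    nbhs (p a) k /\ forall s, N (g (k, s)).
  have small := near_small_set (nbhs_pfilter (p a)).
  by apply: filterS2 small NG => k ka kN; split.
have [cl l0 /(_ ka)[l1 _]] := lP k.
have : (fun s => g (k, s)) = l k.
  apply: line_lift_unique => //.
  - move=> s; apply: (@continuous_comp _ _ _ (fun s => (k, s) : hedgehog R G) g).
      exact: spine_continuous.
    exact: cg.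
  - by apply/funext => s; have := congr1 (@^~ (k, s)) pg.
  - by rewrite l0 -gc.
by move=> /(congr1 (@^~ 1)); rewrite l1 => <-.
Qed.

End lifting.

Theorem corollary3p8 (R : realType) (X : topologicalType) (x0 : X)
  (hX : path_connected R [set: X])
  (E : topologicalType) (p : continuousType E X) (hp : lpc0_covering R p)
  (e0 : E) (he0 : p e0 = x0)
  (H : groupClosed (pi1 R x0))
  (hH : range (pi1_map R p he0) = [set c | c \in H]) :
  forall x : X, hausdorff_space (set_type (p @^-1` [set x])).
Proof.
move=> x a b ab; apply: val_inj; apply: (fibre_separated hp).
  by rewrite (set_valP a) (set_valP b).
move=> A B Aa Bb.
have cval : continuous (\val : set_type (p @^-1` [set x]) -> E).
  exact: initial_continuous.
have [c [Ac Bc]] := ab _ _ (cval a _ Aa) (cval b _ Bb).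
by exists (\val c).
Qed.
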